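(* Let $G$ be a group and let $A$ be a finite set with $|A|\ge 2$. Then: 1. $\mathrm{CA}(G;A)$ is a submonoid of $\mathrm{GCA}(G;A)$. 2. $\mathrm{End}(G)^{\mathrm{op}}$ is isomorphic to a submonoid of $\mathrm{GCA}(G;A)$.
   Context: $A^G$ is the set of all functions $x : G \to A$, with the shift action $(g\cdot x)(h) := x(g^{-1}h)$ for $x \in A^G$, $g,h\in G$. For $\phi\in\mathrm{End}(G)$, a function $\tau : A^G \to A^G$ is a $\phi$-cellular automaton if there are a finite subset $S \subseteq G$ and a function $\mu : A^S \to A$ such that $\tau(x)(g) = \mu((\phi(g^{-1})\cdot x)|_S)$ for all $x \in A^G$, $g \in G$. $\mathrm{GCA}(G;A)$ is the monoid, under composition, of all functions $A^G\to A^G$ that are $\phi$-cellular automata for some $\phi\in\mathrm{End}(G)$. $\mathrm{CA}(G;A)$ is the set of all $\mathrm{id}_G$-cellular automata $A^G\to A^G$. $\mathrm{End}(G)^{\mathrm{op}}$ is the monoid with underlying set $\mathrm{End}(G)$ (group endomorphisms of $G$) and operation $\phi\odot\psi := \psi\circ\phi$. *)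

(* Defs.v *)
From HB Require Import structures.
From mathcomp Require Import all_boot finmap.
From mathcomp Require Import boolp classical_sets functions.

Set Implicit Arguments.
Unset Strict Implicit.
Unset Printing Implicit Defensive.

Local Open Scope group_scope.
Local Open Scope fset_scope.
Local Open Scope classical_set_scope.

Definition submonoid (M : monoidType) (S : set M) : Prop :=
  monoid_closed (mem S).

Definition shift_act (G : groupType) (A : Type) (g : G) (x : G -> A) : G -> A :=
  fun h => x (g^-1 * h).

Definition restr_fset (G : groupType) (A : Type) (S : {fset G}) (x : G -> A) :
    S -> A :=
  fun s => x (val s).

(* UMagmaMorphism.type is the library's type of group morphisms. *)
Definition endo (G : groupType) := UMagmaMorphism.type G G.

(* Alias of End(G) carrying the opposite of composition as its product. *)
Definition End_op (G : groupType) := endo G.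

Definition phi_cellular (G : groupType) (A : Type)
    (phi : endo G) (tau : (G -> A) -> (G -> A)) : Prop :=
  exists (S : {fset G}) (mu : (S -> A) -> A),
    forall (x : G -> A) (g : G),
      tau x g = mu (restr_fset (S := S) (shift_act (phi g^-1) x)).

Definition gca_set (G : groupType) (A : Type) : set ((G -> A) -> (G -> A)) :=
  [set tau | exists phi, phi_cellular phi tau].

Definition ca_set (G : groupType) (A : Type) : set ((G -> A) -> (G -> A)) :=
  [set tau | phi_cellular idfun tau].

Section EndOpMonoid.
Variable G : groupType.
Implicit Types phi psi : End_op G.

Lemma End_op_ext phi psi : phi =1 psi -> phi = psi.
Proof.
case: phi psi => [f [[fM] [f1]]] [g [[gM] [g1]]] /= /funext fg.
case: _ / fg in gM g1 *.
by rewrite (Prop_irrelevance fM gM) (Prop_irrelevance f1 g1).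
Qed.

HB.instance Definition _ := gen_eqMixin (End_op G).
HB.instance Definition _ := gen_choiceMixin (End_op G).

Definition End_op_mul phi psi : End_op G := (psi \o phi : G -> G).

Definition End_op_one : End_op G := @idfun G.

Lemma End_op_mulA : associative End_op_mul.
Proof. by move=> phi psi chi; apply: End_op_ext. Qed.

Lemma End_op_mul1 : left_id End_op_one End_op_mul.
Proof. by move=> phi; apply: End_op_ext. Qed.

Lemma End_op_mulr1 : right_id End_op_one End_op_mul.
Proof. by move=> phi; apply: End_op_ext. Qed.

HB.instance Definition _ :=
  isMonoid.Build (End_op G) End_op_mulA End_op_mul1 End_op_mulr1.

End EndOpMonoid.

Section GCAMonoid.
Variables (G : groupType) (A : choiceType).
Implicit Types sigma tau : (G -> A) -> (G -> A).

Lemma gca_set_id : gca_set (@idfun (G -> A)).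
Proof.
exists (@idfun G), [fset 1], (fun y => y [` fset11 (1 : G)]) => x g.
by rewrite /restr_fset /shift_act /= invgK mulg1.
Qed.

Lemma gca_set_comp sigma tau :
  gca_set sigma -> gca_set tau -> gca_set (sigma \o tau).
Proof.
move=> [phi [S [mu sigmaE]]] [psi [T [nu tauE]]].
pose U : {fset G} := [fset psi s * t | s in S, t in T].
have inU (s : S) (t : T) : psi (val s) * val t \in U.
  exact: in_imfset2 (valP s) (valP t).
exists (psi \o phi), U, (fun y => mu (fun s => nu (fun t => y [` inU s t]))).
move=> x g; rewrite /= sigmaE; congr mu; apply/funext => s.
rewrite /restr_fset /shift_act tauE; congr nu; apply/funext => t.
rewrite /restr_fset /shift_act /=; congr x.
by rewrite !gmulfV !invgK gmulfM mulgA.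
Qed.

(* The subtype of the elements of [gca_set G A], through [set_type]. *)
Definition GCA : Type := gca_set (G := G) (A := A).

HB.instance Definition _ := Choice.on GCA.
HB.instance Definition _ := SubType.on GCA.

Definition gca_mul (s t : GCA) : GCA :=
  exist _ (val s \o val t)
    (mem_set (gca_set_comp (set_mem (valP s)) (set_mem (valP t)))).

Definition gca_one : GCA := exist _ idfun (mem_set gca_set_id).

Lemma gca_mulA : associative gca_mul.
Proof. by move=> r s t; apply: val_inj. Qed.

Lemma gca_mul1 : left_id gca_one gca_mul.
Proof. by move=> s; apply: val_inj. Qed.

Lemma gca_mulr1 : right_id gca_one gca_mul.
Proof. by move=> s; apply: val_inj. Qed.

HB.instance Definition _ :=
  isMonoid.Build GCA gca_mulA gca_mul1 gca_mulr1.

End GCAMonoid.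

Arguments GCA : clear implicits.
Arguments ca_set : clear implicits.
Arguments gca_set : clear implicits.

(* Main.v *)
Require Import Defs.
From mathcomp Require Import all_boot finmap.
From mathcomp Require Import boolp classical_sets functions.

(** The first part rests on how the endomorphism attached to a cellular automaton
behaves under composition: if [sigma] is [phi]-cellular and [tau] is
[psi]-cellular, then [sigma \o tau] is [(psi \o phi)]-cellular
([phi_cellular_comp]).  Hence the automata attached to the identity
endomorphism are stable under composition, and they contain the identity map.

For the second part, an endomorphism [phi] is sent to the precomposition map
[x |-> x \o phi].  It is a [phi]-cellular automaton that reads a single cell,
the identity of [G] ([phi_cellular_precomp]).  Precomposition reverses the
order of composition, which is why the morphism starts from the opposite
monoid.  It is injective because two distinct letters of the alphabet suffice
for a configuration to single out any one element of [G]
([precomp_gca_inj]).  The submonoid sought is the image of this map. *)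

Local Open Scope group_scope.
Local Open Scope fset_scope.
Local Open Scope classical_set_scope.

(** Computing [sigma (tau x)] at [g] reads [tau x] at the cells [phi g * s],
hence [x] at the cells [psi (phi g) * (psi s * t)].  The products [psi s * t]
therefore form a memory set for the composite.  The endomorphism [chi] is
only required to agree with [psi \o phi] pointwise so that the identity can
stand for its own square. *)
Lemma phi_cellular_comp (G : groupType) (A : Type) (phi psi chi : endo G)
    (sigma tau : (G -> A) -> (G -> A)) :
  chi =1 psi \o phi -> phi_cellular phi sigma -> phi_cellular psi tau ->
  phi_cellular chi (sigma \o tau).
Proof.
move=> chiE [S [mu sigmaE]] [T [nu tauE]].
pose U : {fset G} := [fset psi s * t | s in S, t in T].
have inU (s : S) (t : T) : psi (val s) * val t \in U.
  exact: in_imfset2 (valP s) (valP t).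
exists U, (fun y => mu (fun s => nu (fun t => y [` inU s t]))) => x g.
rewrite /= sigmaE; congr mu; apply/funext => s.
rewrite /restr_fset /shift_act tauE; congr nu; apply/funext => t.
rewrite /restr_fset /shift_act chiE /=; congr x.
by rewrite !gmulfV !invgK gmulfM mulgA.
Qed.

Lemma phi_cellular_precomp (G : groupType) (A : Type) (phi : endo G) :
  phi_cellular phi (fun x : G -> A => x \o phi).
Proof.
exists [fset 1], (fun y => y [` fset11 (1 : G)]) => x g.
by rewrite /restr_fset /shift_act /= gmulfV invgK mulg1.
Qed.

Lemma submonoid_ca (G : groupType) (A : choiceType) :
  submonoid [set t : GCA G A | ca_set G A (val t)].
Proof.
split; first by apply/mem_set; exact: (phi_cellular_precomp G A idfun).
move=> s t /set_mem sP /set_mem tP; apply/mem_set.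
exact: phi_cellular_comp sP tP.
Qed.

Definition precomp_gca (G : groupType) (A : choiceType) (phi : End_op G) :
    GCA G A :=
  exist _ (fun x => x \o (phi : endo G))
    (mem_set (ex_intro _ phi (phi_cellular_precomp G A phi))).

Lemma precomp_gca_monoid_morphism (G : groupType) (A : choiceType) :
  monoid_morphism (precomp_gca G A).
Proof. by split=> [|phi psi]; apply: val_inj. Qed.

(** Precomposing the indicator of [phi g], with values in two distinct letters
[a] and [b], by [phi] and by [psi] and evaluating at [g] tells [psi g] apart
from [phi g] whenever they differ. *)
Lemma precomp_gca_inj (G : groupType) (A : choiceType) (a b : A) :
  a != b -> injective (precomp_gca G A).
Proof.
move=> ab phi psi /(congr1 val) /= E; apply: End_op_ext => g.
have /(congr1 (@^~ g)) /= :=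
  congr1 (@^~ (fun h => if h == phi g then a else b)) E.
by rewrite eqxx; case: eqVneq => [->//|_ /eqP]; rewrite (negPf ab).
Qed.

Lemma submonoid_range (M N : monoidType) (f : M -> N) :
  monoid_morphism f -> submonoid (range f).
Proof.
move=> [f1 fM]; split; first by apply/mem_set; exists 1.
move=> _ _ /set_mem[x _ <-] /set_mem[y _ <-].
by apply/mem_set; exists (x * y); rewrite ?fM.
Qed.

Theorem lemma6 (G : groupType) (A : finType) (A_ge2 : (1 < #|A|)%N) :
  (ca_set G A `<=` gca_set G A /\
   submonoid [set t : GCA G A | ca_set G A (val t)]) /\
  (exists M : set (GCA G A), submonoid M /\
     exists f : End_op G -> GCA G A,
       monoid_morphism f /\ set_bij [set: End_op G] M f).
Proof.
split; first by split; [move=> tau tauP; exists idfun | exact: submonoid_ca].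
have fM := precomp_gca_monoid_morphism G A.
have /card_gt1P[a [b [_ _ ab]]] := A_ge2.
exists (range (precomp_gca G A)); split; first exact: submonoid_range.
exists (precomp_gca G A); split=> //; split=> // phi psi _ _.
exact: precomp_gca_inj ab _ _.
Qed.
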